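(* Let $G$ be a diamond-free graph, and let $G \cup \{v\}$ be the graph obtained from $G$ by adding a new vertex $v \notin V(G)$ adjacent exactly to a given set $N(v) \subseteq V(G)$. Let $N'(v)$ be the set of edges of $G$ both of whose endpoints belong to $N(v)$. Say that $v$ is edge-adjacent to a clique $C$ of $G$ if $E(C) \cap N'(v) \neq \emptyset$, and fully edge-adjacent to $C$ if $E(C) \subseteq N'(v)$. Then $G \cup \{v\}$ is diamond-free if and only if, for every maximal clique $C$ of $G$ to which $v$ is edge-adjacent, the following two statements hold: (1) $v$ is fully edge-adjacent to $C$, and (2) for every maximal clique $C' \neq C$ of $G$ to which $v$ is edge-adjacent, $V(C') \cap V(C) = \emptyset$.
   Context: All graphs are finite, simple and undirected. A diamond is the graph obtained from $K_4$ by removing one edge; a graph is diamond-free if it has no induced subgraph isomorphic to a diamond. A clique is a set of pairwise adjacent vertices (identified with the subgraph it induces); it is maximal if it is not properly contained in another clique. *)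

(* Defs.v *)
From mathcomp Require Import all_boot.

Set Implicit Arguments.
Unset Strict Implicit.
Unset Printing Implicit Defensive.

Record sgraph (V : finType) := SGraph {
  adj :> rel V;
  adj_sym : symmetric adj;
  adj_irr : irreflexive adj
}.

Definition isomorphic (V W : finType) (G : sgraph V) (H : sgraph W) : Prop :=
  exists2 f : V -> W, bijective f & forall x y, adj H (f x) (f y) = adj G x y.

Section Constructions.

Variables (V : finType) (G : sgraph V).

Section Induced.
Variable A : {set V}.
Definition induced_rel : rel {x : V | x \in A} :=
  [rel x y | adj G (val x) (val y)].
Fact induced_sym : symmetric induced_rel.
Proof. by move=> x y; apply: adj_sym. Qed.
Fact induced_irr : irreflexive induced_rel.
Proof. by move=> x; apply: adj_irr. Qed.
Definition induced : sgraph {x : V | x \in A} := SGraph induced_sym induced_irr.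
End Induced.

Section DelEdge.
Variables a b : V.
Definition del_edge_rel : rel V :=
  [rel x y | adj G x y && ([set x; y] != [set a; b])].
Fact del_edge_sym : symmetric del_edge_rel.
Proof. by move=> x y; rewrite /del_edge_rel /= (adj_sym G x y) setUC. Qed.
Fact del_edge_irr : irreflexive del_edge_rel.
Proof. by move=> x; rewrite /del_edge_rel /= (adj_irr G x). Qed.
Definition del_edge : sgraph V := SGraph del_edge_sym del_edge_irr.
End DelEdge.

(* The new vertex is [None]; the old vertices are the [Some x]. *)
Section AddVertex.
Variable N : {set V}.
Definition add_vertex_rel : rel (option V) := fun x y =>
  match x, y with
  | Some x', Some y' => adj G x' y'
  | Some x', None => x' \in N
  | None, Some y' => y' \in N
  | None, None => false
  end.
Fact add_vertex_sym : symmetric add_vertex_rel.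
Proof. by move=> [x|] [y|] //=; apply: adj_sym. Qed.
Fact add_vertex_irr : irreflexive add_vertex_rel.
Proof. by move=> [x|] //=; apply: adj_irr. Qed.
Definition add_vertex : sgraph (option V) :=
  SGraph add_vertex_sym add_vertex_irr.
End AddVertex.

End Constructions.

Section Complete.
Variable V : finType.
Definition complete_rel : rel V := [rel x y | x != y].
Fact complete_sym : symmetric complete_rel.
Proof. by move=> x y; rewrite /complete_rel /= eq_sym. Qed.
Fact complete_irr : irreflexive complete_rel.
Proof. by move=> x; rewrite /complete_rel /= eqxx. Qed.
Definition complete : sgraph V := SGraph complete_sym complete_irr.
End Complete.

Definition diamond : sgraph 'I_4 := del_edge (complete 'I_4) ord0 ord_max.

Definition diamond_free (V : finType) (G : sgraph V) : Prop :=
  ~ exists A : {set V}, isomorphic (induced G A) diamond.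

Section Cliques.

Variables (V : finType) (G : sgraph V).

Definition clique (C : {set V}) : bool :=
  [forall x in C, forall y in C, (x != y) ==> adj G x y].

Definition maximal_clique (C : {set V}) : bool := maxset clique C.

Definition edges : {set {set V}} :=
  [set [set x; y] | x in V, y in V & adj G x y].

(* Edges of the subgraph induced by [A]: this is both E(C), for [A] a clique C,
   and N'(v), for [A] the neighbourhood N(v). *)
Definition edges_in (A : {set V}) : {set {set V}} :=
  [set e in edges | e \subset A].

Definition edge_adjacent (N C : {set V}) : bool :=
  edges_in C :&: edges_in N != set0.

Definition fully_edge_adjacent (N C : {set V}) : bool :=
  edges_in C \subset edges_in N.

End Cliques.

(* Main.v *)
Require Import Defs.
From mathcomp Require Import all_boot.

Set Implicit Arguments.
Unset Strict Implicit.
Unset Printing Implicit Defensive.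

(** A graph is diamond-free iff any two distinct common neighbours of the ends
    of an edge are adjacent.  If [G + v] is diamond-free and [v] sees an edge of
    a maximal clique [C], it therefore sees all of [C]; and if [C], [C'] are two
    such cliques sharing a vertex [z], the edge [vz] makes the union of [C] and
    [C'] a clique, so [C = C'].  Conversely, a diamond of [G + v] must contain
    [v]: if [v] has degree 2 in it, the other three vertices lie in a maximal
    clique contradicting (1); if [v] has degree 3, the two edges between its
    neighbours extend to maximal cliques contradicting (2). *)

Lemma diamondE i j :
  diamond i j =
  [&& i != j, ~~ ((i == ord0) && (j == ord_max))
            & ~~ ((i == ord_max) && (j == ord0))].
Proof.
rewrite -[LHS]/((i != j) && ([set i; j] != [set ord0; ord_max])).
rewrite eqEsubset !subUset !sub1set !inE.
by case: i j => [[|[|[|[|i]]]] Hi] // [[|[|[|[|j]]]] Hj].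
Qed.

Lemma diamond_freeP (V : finType) (G : sgraph V) :
  diamond_free G <->
  (forall a b x y, x != y -> G a b -> G a x -> G b x -> G a y -> G b y ->
     G x y).
Proof.
split=> [dfG a b x y xy ab ax bx ay by_ | common [A [f [g fK gK] fadj]]].
  apply/negP => /negP nxy; apply: dfG.
  have neq u w : G u w -> (u == w) = false.
    by move=> uw; apply/eqP => E; rewrite E adj_irr in uw.
  have ba : G b a by rewrite adj_sym.
  have xa : G x a by rewrite adj_sym.
  have xb : G x b by rewrite adj_sym.
  have ya : G y a by rewrite adj_sym.
  have yb : G y b by rewrite adj_sym.
  have nyx : ~~ G y x by rewrite adj_sym.
  (* In this order the non-adjacent pair [x], [y] gets the indices 0 and 3, the ends of the edge
     missing from [diamond]. *)
  pose s := [:: x; a; b; y].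
  have us : uniq s by rewrite /= !inE !negb_or xy !neq.
  have sz (u : {z | z \in [set z in s]}) : index (val u) s < 4.
    by have := valP u; rewrite inE -index_mem.
  pose f u := Ordinal (sz u).
  have gP (i : 'I_4) : nth x s i \in [set z in s] by rewrite inE mem_nth.
  exists [set z in s], f.
    exists (fun i : 'I_4 => Sub (nth x s i) (gP i)) => [u | i];
      apply: val_inj.
      by apply: (@nth_index _ x (val u)); rewrite -index_mem; apply: sz.
    exact: (@index_uniq _ x i s).
  move=> u w.
  (* The index bounds, read as membership in [s], leave sixteen explicit pairs to check. *)
  have := sz u; have := sz w; rewrite !index_mem !inE => sw su.
  rewrite diamondE -!val_eqE -[RHS]/(G (val u) (val w)) /=.
  have yx : (y == x) = false by rewrite eq_sym (negbTE xy).
  by case/or4P: su => /eqP->; case/or4P: sw => /eqP->;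
    rewrite ?eqxx ?(negbTE xy) ?yx ?neq //= ?adj_irr ?(negbTE nxy)
            ?(negbTE nyx) ?ab ?ba ?ax ?xa ?bx ?xb ?ay ?ya ?by_ ?yb.
pose v i := val (g i).
have vadj i j : G (v i) (v j) = diamond i j.
  by rewrite -[RHS]/(adj _ i j) -(gK i) -(gK j) fadj /= !gK.
(* The vertices 1 and 2 have degree 3 in [diamond]: they span the edge whose common neighbours 0 and
   3 are not adjacent. *)
pose o1 := @Ordinal 4 1 isT; pose o2 := @Ordinal 4 2 isT.
have : G (v ord0) (v ord_max).
  apply: (common (v o1) (v o2)); rewrite ?vadj ?diamondE //.
  by rewrite (inj_eq val_inj) (can_eq gK).
by rewrite vadj diamondE.
Qed.

Section MaximalCliques.
Variables (V : finType) (G : sgraph V).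
Implicit Types (x y z : V) (C N : {set V}).

Lemma cliqueP C :
  reflect {in C &, forall x y, x != y -> G x y} (clique G C).
Proof.
apply: (iffP forall_inP) => [cC x y xC yC | cC x xC].
  by move/forall_inP: (cC x xC) => /(_ y yC)/implyP.
by apply/forall_inP => y yC; apply/implyP; apply: cC.
Qed.

Lemma maximal_clique_clique C : maximal_clique G C -> clique G C.
Proof. by case/maxsetP. Qed.

Lemma clique_extend C :
  clique G C -> exists2 D, maximal_clique G D & C \subset D.
Proof. by move=> /maxset_exists[D mD sCD]; exists D. Qed.

Lemma triangle_clique x y z :
  G x y -> G x z -> G y z -> clique G [set x; y; z].
Proof.
move=> xy xz yz; apply/cliqueP => u w; rewrite !inE -!orbA.
by case/or3P=> /eqP-> /or3P[] /eqP->; rewrite ?eqxx // adj_sym.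
Qed.

Lemma edge_clique x y : G x y -> clique G [set x; y].
Proof.
move=> xy; apply/cliqueP => u w; rewrite !inE.
by case/orP=> /eqP-> /orP[] /eqP->; rewrite ?eqxx // adj_sym.
Qed.

Lemma mem_edges_in C x y :
  G x y -> x \in C -> y \in C -> [set x; y] \in edges_in G C.
Proof.
move=> xy xC yC; rewrite inE subUset !sub1set xC yC !andbT.
by apply/imset2P; exists x y; rewrite ?inE.
Qed.

Lemma edges_inP C e :
  reflect (exists x y, [/\ G x y, x \in C, y \in C & e = [set x; y]])
          (e \in edges_in G C).
Proof.
apply: (iffP idP) => [|[x [y [xy xC yC ->]]]]; last exact: mem_edges_in.
rewrite inE => /andP[/imset2P[x y _]]; rewrite inE => /andP[_ xy] ->.
by rewrite subUset !sub1set => /andP[xC yC]; exists x, y.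
Qed.

Lemma edge_adjacentP N C :
  reflect (exists x y, [/\ G x y, x \in C :&: N & y \in C :&: N])
          (edge_adjacent G N C).
Proof.
apply: (iffP (set0Pn _)) => [[e] | [x [y [xy /setIP[xC xN] /setIP[yC yN]]]]].
  rewrite inE => /andP[/edges_inP[x [y [xy xC yC ->]]]].
  rewrite inE subUset !sub1set => /and3P[_ xN yN].
  by exists x, y; rewrite !inE xC yC xN yN.
by exists [set x; y]; rewrite inE !mem_edges_in.
Qed.

(** A one-vertex clique has no edge and is fully edge-adjacent vacuously; the neighbour [x] supplies
    an edge of [C] at [y]. *)
Lemma fully_edge_adjacent_mem N C x y :
  fully_edge_adjacent G N C -> G x y -> x \in C -> y \in C -> y \in N.
Proof.
move=> /subsetP fC xy xC yC; have := fC _ (mem_edges_in xy xC yC).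
by rewrite inE subUset !sub1set => /and3P[].
Qed.

Lemma subset_fully_edge_adjacent N C :
  C \subset N -> fully_edge_adjacent G N C.
Proof.
move=> /subsetP CN; apply/subsetP => e /edges_inP[x [y [xy xC yC ->]]].
by apply: mem_edges_in => //; apply: CN.
Qed.

Lemma maximal_cliqueU C C' :
  maximal_clique G C -> maximal_clique G C' -> clique G (C :|: C') -> C' = C.
Proof.
move=> /maxsetP[_ maxC] /maxsetP[_ maxC'] cU.
by rewrite -(maxC' _ cU (subsetUr _ _)) (maxC _ cU (subsetUl _ _)).
Qed.

End MaximalCliques.

Theorem theorem5 (V : finType) (G : sgraph V) (N : {set V}) :
  diamond_free G ->
  (diamond_free (add_vertex G N) <->
   forall C : {set V}, maximal_clique G C -> edge_adjacent G N C ->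
     fully_edge_adjacent G N C /\
     (forall C' : {set V}, C' <> C -> maximal_clique G C' ->
        edge_adjacent G N C' -> C' :&: C = set0)).
Proof.
move=> /diamond_freeP dfG; split=> [/diamond_freeP dfGv | cond].
  have sub_N C : maximal_clique G C -> edge_adjacent G N C -> C \subset N.
    move=> /maximal_clique_clique/cliqueP cC /edge_adjacentP.
    move=> [x [y [xy /setIP[xC xN] /setIP[yC yN]]]].
    apply/subsetP => z zC.
    have [<- // | xz] := eqVneq x z; have [<- // | yz] := eqVneq y z.
    (* The new vertex and [z] are common neighbours of the ends of the edge [xy]. *)
    by apply: (dfGv (Some x) (Some y) None (Some z)) => //=; apply: cC.
  move=> C mC aC; split; first exact/subset_fully_edge_adjacent/sub_N.
  move=> C' neqC mC' aC'; apply/eqP/set0Pn => -[z /setIP[zC' zC]].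
  have /subsetP CN := sub_N _ mC aC; have /subsetP C'N := sub_N _ mC' aC'.
  have /cliqueP cC := maximal_clique_clique mC.
  have /cliqueP cC' := maximal_clique_clique mC'.
  apply: neqC; apply: maximal_cliqueU mC mC' _.
  have cross x y : x \in C -> y \in C' -> x != y -> G x y.
    move=> xC yC' xy.
    (* If the shared vertex [z] is [x] or [y], then both lie in one of the two cliques; otherwise
       both are common neighbours of [z] and the new vertex. *)
    have [zx | zx] := eqVneq z x; first by apply: cC'; rewrite -?zx // zx.
    have [zy | zy] := eqVneq z y; first by apply: cC; rewrite -?zy // zy.
    by apply: (dfGv None (Some z) (Some x) (Some y)) => //=; auto.
  apply/cliqueP => x y; rewrite !inE.
  case/orP=> xC /orP[] yC xy; auto.
  by rewrite adj_sym; apply: cross; rewrite // eq_sym.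
(* The new vertex has degree 2: a maximal clique containing the triangle [a], [b], [y] has the edge
   [ab] inside [N], so (1) applies to it. *)
have nbr a b y : G a b -> a \in N -> b \in N -> G a y -> G b y -> y \in N.
  move=> ab aN bN ay by_.
  have [C mC /subsetP sC] := clique_extend (triangle_clique ab ay by_).
  have [aC bC yC] : [/\ a \in C, b \in C & y \in C].
    by split; apply: sC; rewrite !inE eqxx ?orbT.
  have [|fC _] := cond C mC.
    by apply/edge_adjacentP; exists a, b; rewrite !inE aC bC aN.
  exact: fully_edge_adjacent_mem fC ay aC yC.
(* The new vertex has degree 3: maximal cliques through [bx] and [by] share [b], so by (2) they
   coincide and contain both [x] and [y]. *)
have link b x y : x != y -> b \in N -> x \in N -> y \in N -> G b x -> G b y ->
    G x y.
  move=> xy bN xN yN bx by_.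
  have [C mC /subsetP sC] := clique_extend (edge_clique bx).
  have [C' mC' /subsetP sC'] := clique_extend (edge_clique by_).
  have [bC xC] : b \in C /\ x \in C by split; apply: sC; rewrite !inE eqxx ?orbT.
  have [bC' yC'] : b \in C' /\ y \in C'.
    by split; apply: sC'; rewrite !inE eqxx ?orbT.
  have aC : edge_adjacent G N C.
    by apply/edge_adjacentP; exists b, x; rewrite !inE bC xC bN.
  have aC' : edge_adjacent G N C'.
    by apply/edge_adjacentP; exists b, y; rewrite !inE bC' yC' bN.
  have [_ disj] := cond C mC aC.
  have [EC | /eqP neqC] := eqVneq C' C.
    have /cliqueP cC := maximal_clique_clique mC.
    by apply: cC; rewrite -?EC // EC.
  by have /setP/(_ b) := disj C' neqC mC' aC'; rewrite !inE bC bC'.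
(* The new vertex occurs at most once among the four, so five cases remain: it is absent, or it is
   [y], [x], [b], [a], in this order. *)
apply/diamond_freeP => -[a|] [b|] [x|] [y|] //= xy ab ax bx ay by_.
- exact: (dfG a b).
- exact: (nbr a b).
- exact: (nbr a b).
- exact: (link a).
- exact: (link b).
Qed.
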